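(* Let $(X,\lambda)$ be a convergence approach space and let $A\subset X$. Then the adherence function $\operatorname{adh}A:X\to V$ is a morphism from $(X,\lambda)$ to $(V,\lambda_V)$, i.e. $\operatorname{adh}A\in\mathscr{C}(X,V)$, if and only if for every $\epsilon\in V$ and every $x\in X$, $$\operatorname{adh}A(x)\;\geq\;\operatorname{adh}A^{(\epsilon)}(x)\otimes\epsilon .$$
   Context: Throughout, $V=[0,1]$ with its usual order and $\otimes$ is multiplication (equivalently, via $-\ln$, $V=[0,\infty]^{op}$ with $\otimes=+$). Division is $t\oslash x=\min(t/x,1)$ if $x\neq 0$ and $t\oslash 0=1$; equivalently $v\otimes x\le y\iff x\le y\oslash v$. Filters are proper; $\mathbb{F}X$ (resp. $\mathbb{U}X$) is the set of filters (resp. ultrafilters) on $X$, and $\{x\}^{\uparrow}$ is the principal ultrafilter of $x$. $V^X$ carries the pointwise order. A convergence approach space $(X,\lambda)$ is a set $X$ with a map $\lambda:\mathbb{F}X\to V^X$ such that $\mathcal F\subset\mathcal G$ implies $\lambda(\mathcal F)\le\lambda(\mathcal G)$, and $\lambda(\{x\}^{\uparrow})(x)=1$ for all $x$. A morphism $f:(X,\lambda_X)\to(Y,\lambda_Y)$ is a map with $\lambda_X(\mathcal F)(x)\le\lambda_Y(f[\mathcal F])(f(x))$ for all $\mathcal F\in\mathbb{F}X$, $x\in X$, where $f[\mathcal F]$ is the image filter; $\mathscr{C}(X,Y)$ is the set of morphisms. For $A\subset X$, $\operatorname{adh}A(x)=\operatorname{adh}_\lambda A(x)=\bigvee\{\lambda(\mathcal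 U)(x):\mathcal U\in\mathbb{U}X,\ A\in\mathcal U\}$ (with $\bigvee\emptyset=0$), and for $\epsilon\in V$, $A^{(\epsilon)}=\{x\in X:\operatorname{adh}A(x)\ge\epsilon\}$. $V$ carries the convergence approach structure $\lambda_V(\mathcal F)(v)=v\oslash\bigvee\{\bigwedge A: A\subset V,\ A\cap F\ne\emptyset\ \forall F\in\mathcal F\}=v\oslash\bigwedge_{F\in\mathcal F}\bigvee F$, and $\mathscr{C}(X,V)$ denotes morphisms from $(X,\lambda)$ to $(V,\lambda_V)$. *)

(* Defs.v *)
From mathcomp Require Import all_boot all_order all_algebra.
From mathcomp Require Import interval_inference.
From mathcomp Require Import boolp classical_sets filter reals.

Set Implicit Arguments.
Unset Strict Implicit.
Unset Printing Implicit Defensive.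

Import Order.TTheory GRing.Theory Num.Theory.

Local Open Scope classical_set_scope.
Local Open Scope ring_scope.

Section Quantale.
Variable R : realType.
Local Notation V := {i01 R}.

(* The default values make these the join and meet of the complete lattice V
   also on the empty set. *)
Definition vsup (S : set V) : V := supremum 0%:i01 S.
Definition vinf (S : set V) : V := infimum 1%:i01 S.

Definition vmul (x y : V) : V := (x%:num * y%:num)%:i01.

(* The case x = 0 is separate because t / 0 is 0 in MathComp. *)
Definition vdiv (t x : V) : V :=
  if x%:num == 0 then 1%:i01 else (Num.min (t%:num / x%:num) 1)%:i01.

Lemma vsup_supremums (S : set V) : supremums S (vsup S).
Proof.
rewrite /vsup /supremum; case: ifPn => [/eqP ->|/set0P[s Ss]].
  by split=> [y //|y _]; rewrite -num_le /=; exact: ge0.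
pose E : set R := [set x%:num | x in S].
have hE : has_sup E.
  split; first by exists s%:num, s.
  by exists 1 => _ [x _ <-]; exact: le1.
have E0 : 0 <= sup E.
  apply: le_trans (ge0 s) _; apply: sup_upper_bound => //.
  by exists s.
have E1 : sup E <= 1.
  by apply: ge_sup; [case: hE | move=> _ [x _ <-]; exact: le1].
case: xgetP => // /(_ (Itv01 E0 E1)); case; split => [x Sx|y Sy].
  by rewrite -num_le /=; apply: sup_upper_bound => //; exists x.
rewrite -num_le /=; apply: ge_sup; first by case: hE.
by move=> _ [x Sx <-]; rewrite num_le; exact: Sy.
Qed.

Lemma vinf_infimums (S : set V) : infimums S (vinf S).
Proof.
rewrite /vinf /infimum; case: ifPn => [/eqP ->|/set0P[s Ss]].
  by split=> [y //|y _]; rewrite -num_le /=; exact: le1.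
have [ub lub] := vsup_supremums (lbound S).
case: xgetP => // /(_ (vsup (lbound S))); case; split => // x Sx.
by apply: lub => y; exact.
Qed.

Lemma vdivP (v x y : V) : (vmul v x <= y)%O <-> (v <= vdiv y x)%O.
Proof.
rewrite /vdiv; case: eqP => [x0|/eqP x0].
  split=> _; rewrite -num_le /=; first exact: le1.
  by rewrite x0 mulr0; exact: ge0.
have xp : 0 < x%:num by rewrite lt_def x0 ge0.
by rewrite -!num_le /= le_min le1 andbT ler_pdivlMr.
Qed.

Lemma vdivv (v : V) : vdiv v v = 1%:i01.
Proof.
apply/eqP; rewrite eq_le; apply/andP; split; first by rewrite -num_le; exact: le1.
by apply/vdivP; rewrite -num_le /= mul1r.
Qed.

Lemma vdiv_anti (t x y : V) : (x <= y)%O -> (vdiv t y <= vdiv t x)%O.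
Proof.
move=> xy; apply/vdivP.
have : (vmul (vdiv t y) y <= t)%O by apply/vdivP.
apply: le_trans; rewrite -num_le /=; apply: ler_wpM2l; first exact: ge0.
by rewrite num_le.
Qed.

End Quantale.

Section Convergence.
Variable R : realType.
Local Notation V := {i01 R}.

Definition principal_pfilter (X : Type) (x : X) : pfilter_on X :=
  PFilterPack _ (principal_filter_proper x).

(* The preimage form {B | f @^-1` B in F} is the filter generated by the sets
   f @` A with A in F. *)
Definition image_pfilter (X Y : Type) (f : X -> Y) (F : pfilter_on X) :
    pfilter_on Y :=
  PFilterPack _ (fmap_proper_filter f (pfilter_class F)).

Record convapp (X : Type) := ConvApp {
  clim :> pfilter_on X -> X -> V ;
  clim_mono : forall (F G : pfilter_on X),
    (F : set_system X) `<=` (G : set_system X) ->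
    forall x, (clim F x <= clim G x)%O ;
  clim_principal : forall x, clim (principal_pfilter x) x = 1%:i01
}.

Definition convapp_hom (X Y : Type) (lX : convapp X) (lY : convapp Y) :
    set (X -> Y) :=
  [set f | forall (F : pfilter_on X) (x : X),
     (lX F x <= lY (image_pfilter f F) (f x))%O].

Definition adh (X : Type) (l : convapp X) (A : set X) (x : X) : V :=
  vsup [set l U x | U in
    [set U : pfilter_on X | UltraFilter (U : set_system X) /\
                            (U : set_system X) A]].

Definition adh_level (X : Type) (l : convapp X) (A : set X) (e : V) : set X :=
  [set x | (e <= adh l A x)%O].

(* A ranges over the grill of F; vlimsupE gives the usual limsup formula. *)
Definition vlimsup (F : pfilter_on V) : V :=
  vsup [set vinf A | A in
    [set A : set V | forall B, (F : set_system V) B -> A `&` B !=set0]].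

Lemma vlimsupE (F : pfilter_on V) :
  vlimsup F = vinf [set vsup B | B in (F : set_system V)].
Proof.
have [ub lub] := vsup_supremums [set vinf A | A in
    [set A : set V | forall B, (F : set_system V) B -> A `&` B !=set0]].
have [lb glb] := vinf_infimums [set vsup B | B in (F : set_system V)].
apply/eqP; rewrite eq_le; apply/andP; split.
  apply: lub => _ [A AF <-]; apply: glb => _ [B FB <-].
  have [z [Az Bz]] := AF _ FB.
  apply: (@le_trans _ _ z).
    by have [+ _] := vinf_infimums A; apply.
  by have [+ _] := vsup_supremums B; apply.
set m := vinf _ in lb glb *; rewrite leNgt; apply/negP => sm.
have le01 (z : V) : 0 <= z%:num :> R by exact: ge0.
have le11 (z : V) : z%:num <= 1 :> R by exact: le1.
set s := vlimsup F in sm.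
have sm' : s%:num < m%:num by rewrite num_lt.
pose c := (s%:num + m%:num) / 2.
have sc : s%:num < c by rewrite midf_lt.
have cm : c < m%:num by rewrite midf_lt.
have c0 : 0 <= c by exact: le_trans (le01 s) (ltW sc).
have c1 : c <= 1 by exact: le_trans (ltW cm) (le11 m).
pose cv : V := Itv01 c0 c1.
pose A := [set z : V | (cv <= z)%O].
have AF B : (F : set_system V) B -> A `&` B !=set0.
  move=> FB; apply: contrapT => AB.
  have : (m <= cv)%O.
    apply: (@le_trans _ _ (vsup B)); first by apply: lb; exists B.
    have [_ +] := vsup_supremums B; apply => z Bz.
    by rewrite leNgt; apply/negP => /ltW zc; apply: AB; exists z.
  by rewrite -num_le /= leNgt cm.
have : (vinf A <= s)%O by apply: ub; exists A.
have cA : (cv <= vinf A)%O by have [_ +] := vinf_infimums A; apply => z.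
move=> /(le_trans cA); rewrite -num_le /= => /(lt_le_trans sc).
by rewrite ltxx.
Qed.

Definition vclim (F : pfilter_on V) (v : V) : V := vdiv v (vlimsup F).

Lemma vclim_mono (F G : pfilter_on V) :
  (F : set_system V) `<=` (G : set_system V) ->
  forall v, (vclim F v <= vclim G v)%O.
Proof.
move=> FG v; apply: vdiv_anti.
have [_ lub] := vsup_supremums [set vinf A | A in
    [set A : set V | forall B, (G : set_system V) B -> A `&` B !=set0]].
apply: lub => _ [A AG <-].
have [+ _] := vsup_supremums [set vinf A | A in
    [set A : set V | forall B, (F : set_system V) B -> A `&` B !=set0]].
by apply; exists A => // B /FG; exact: AG.
Qed.

Lemma vclim_principal (v : V) : vclim (principal_pfilter v) v = 1%:i01.
Proof.
rewrite /vclim; suff -> : vlimsup (principal_pfilter v) = v by exact: vdivv.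
rewrite /vlimsup; set S := [set _ | _ in _].
have [ub lub] := vsup_supremums S.
apply/eqP; rewrite eq_le; apply/andP; split.
  apply: lub => _ [A Av <-].
  have [z [Az zv]] : A `&` [set v] !=set0 by apply: Av; exact/principal_filterP.
  by have [+ _] := vinf_infimums A; apply; rewrite -zv.
apply: ub; exists [set v]; last first.
  by have := vinf_infimums [set v]; rewrite infimums1.
by move=> B /principal_filterP Bv; exists v.
Qed.

Definition vconvapp : convapp V := ConvApp vclim_mono vclim_principal.

End Convergence.

(* Main.v *)
Require Import Defs.
From mathcomp Require Import all_boot all_order all_algebra.
From mathcomp Require Import interval_inference.
From mathcomp Require Import boolp classical_sets filter reals.

(** For [f = adh l A], continuity means [l F x * limsup_F f <= f x]. The level
    set [adh_level l A e] is [f^-1 [e, 1]], so an ultrafilter contains it only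
    if its limsup of [f] is at least [e]; conversely, when the meet [e] of a
    grill element of [f[F]] contributes to the limsup, [F] meets this level set
    and hence refines to an ultrafilter containing it. *)

Import Order.TTheory.

Local Open Scope classical_set_scope.
Local Open Scope ring_scope.

Lemma vmulC (R : realType) (x y : {i01 R}) : vmul x y = vmul y x.
Proof. by apply/val_inj; rewrite /= GRing.mulrC. Qed.

Lemma vsup_leP (R : realType) (S : set {i01 R}) (y : {i01 R}) :
  (vsup S <= y)%O <-> forall x, S x -> (x <= y)%O.
Proof.
have [ub lub] := vsup_supremums S; split=> [Sy x Sx|]; last exact: lub.
exact: le_trans (ub x Sx) Sy.
Qed.

Lemma le_vsup (R : realType) (S : set {i01 R}) (x : {i01 R}) :
  S x -> (x <= vsup S)%O.
Proof. exact: (vsup_leP _ _ _).1 (lexx _) x. Qed.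

Lemma vinf_geP (R : realType) (S : set {i01 R}) (y : {i01 R}) :
  (y <= vinf S)%O <-> forall x, S x -> (y <= x)%O.
Proof.
have [lb glb] := vinf_infimums S; split=> [yS x Sx|]; last exact: glb.
exact: le_trans yS (lb x Sx).
Qed.

Lemma within_proper (T : Type) (D : set T) (F : set_system T) :
  ProperFilter F -> (forall B, F B -> B `&` D !=set0) ->
  ProperFilter (within D F).
Proof.
move=> FF FD; apply: Build_ProperFilter => FnD.
by have [x [nDx Dx]] := FD _ FnD; exact: nDx.
Qed.

(** Since [F] meets [A], its trace [within A F] is a proper filter containing both [F] and [A]; any
    ultrafilter above it is a competitor in the supremum [adh l A x], and [clim_mono] compares it
    with [F]. *)
Lemma clim_le_adh (R : realType) (X : Type) (l : convapp R X) (A : set X)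
    (F : pfilter_on X) (x : X) :
  (forall B, (F : set_system X) B -> B `&` A !=set0) ->
  (l F x <= adh l A x)%O.
Proof.
move=> /(within_proper _ _ _ (pfilter_class F)) /ultraFilterLemma [U [UU FAU]].
pose U' := PFilterPack U (@ultra_proper _ _ UU).
apply: (@le_trans _ _ (l U' x)).
  by apply: clim_mono => B FB; apply: FAU; apply: filterS FB => y By _.
by apply: le_vsup; exists U' => //; split=> //; apply: FAU; exact: withinT.
Qed.

Lemma vlimsup_image_ge (R : realType) (X : Type) (f : X -> {i01 R})
    (e : {i01 R}) (F : pfilter_on X) :
  (F : set_system X) [set x | (e <= f x)%O] ->
  (e <= vlimsup (image_pfilter f F))%O.
Proof.
(* The interval from [e] to 1 lies in the grill of the image filter. *)
move=> Fe; apply: (@le_trans _ _ (vinf [set z | (e <= z)%O])).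
  by apply/vinf_geP.
apply: le_vsup; exists [set z | (e <= z)%O] => // B FB.
have [y [ey By]] := filter_ex (filterI Fe FB).
by exists (f y).
Qed.

Theorem theorem9 (R : realType) (X : Type) (l : convapp R X) (A : set X) :
  convapp_hom l (vconvapp R) (adh l A) <->
  (forall (e : {i01 R}) (x : X),
     (vmul (adh l (adh_level l A e) x) e <= adh l A x)%O).
Proof.
split=> [hom e x|level F x].
  apply/vdivP/vsup_leP => _ [U [_ Ue] <-].
  exact: le_trans (hom U x) (vdiv_anti _ (vlimsup_image_ge _ _ _ _ _ Ue)).
(* Residuating in the other factor isolates the limsup, so that it can be bounded one grill element
   [B] at a time; the next line swaps the factors back. *)
apply/vdivP; rewrite vmulC; apply/vdivP/vsup_leP => _ [B FB <-].
apply/vdivP; rewrite vmulC; apply/vdivP.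
apply: (@le_trans _ _ (adh l (adh_level l A (vinf B)) x)); last first.
  by apply/vdivP.
apply: clim_le_adh => C FC.
(* The direct image of [C] is in the image filter because its preimage contains [C]. *)
have [z [Bz [y Cy yz]]] : B `&` (adh l A @` C) !=set0.
  by apply: FB; apply: filterS FC => y Cy; exists y.
by exists y; split=> //=; rewrite /adh_level /= yz; apply: (vinf_geP _ _ _).1 Bz.
Qed.
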